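(* Let $F=G+H$ be as in the context, where each $h_j:\mathbb{R}^n\to\mathbb{R}$ is continuously differentiable, each $g_j:\mathbb{R}^n\to\mathbb{R}\cup\{+\infty\}$ is proper, convex and lower semicontinuous, and $\mathrm{dom}(G)$ is convex and compact. Assume in addition that, for every $j\in\mathcal{J}$, $g_j$ is Lipschitz continuous with constant $L_{g_j}>0$ on $\mathrm{dom}(g_j)$ and $\nabla h_j$ is Lipschitz continuous with constant $L_j>0$. Let $\varepsilon>0$. Then the generalized conditional gradient method with Armijo step sizes generates a point $x^k$ such that $|\theta(x^k)|\le\varepsilon$, performing at most $$m\left[\left(1+\frac{\ln(\gamma\varepsilon)}{\ln(\omega_2)}\right)\frac{f_{j^*}(x^0)-f_{j^*}^{\inf}}{\zeta\gamma}\,\frac{1}{\varepsilon^2}+1\right]=\mathcal{O}(|\ln(\varepsilon)|\varepsilon^{-2})$$ evaluations of the functions $f_1,\dots,f_m$, and at most $$m\left[\frac{f_{j^*}(x^0)-f_{j^*}^{\inf}}{\zeta\gamma}\,\frac{1}{\varepsilon^2}+1\right]=\mathcal{O}(\varepsilon^{-2})$$ evaluations of the gradients $\nabla h_1,\dots,\nabla h_m$.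
   Context: $\mathcal{J}=\{1,\dots,m\}$, $e=(1,\dots,1)^T\in\mathbb{R}^m$, $\|\cdot\|$ is the Euclidean norm, and $u\preceq v$ in $\mathbb{R}^m$ means $v-u\in\mathbb{R}^m_+$. $F=(f_1,\dots,f_m)$, $f_j=g_j+h_j$, $G=(g_1,\dots,g_m)$, $H=(h_1,\dots,h_m)$, $\mathrm{dom}(g_j)=\{x\in\mathbb{R}^n:g_j(x)<+\infty\}$, $\mathrm{dom}(G)=\bigcap_{j\in\mathcal{J}}\mathrm{dom}(g_j)$. For $x\in\mathrm{dom}(G)$, $\theta(x):=\min_{u\in\mathbb{R}^n}\max_{j\in\mathcal{J}}\big(g_j(u)-g_j(x)+\langle\nabla h_j(x),u-x\rangle\big)\le 0$, and $p(x)\in\mathrm{dom}(G)$ denotes a point $u$ attaining this minimum. Generalized conditional gradient method: choose $x^0\in\mathrm{dom}(G)$; for $k=0,1,\dots$ compute a minimizer $p(x^k)$ and the value $\theta(x^k)$; stop if $\theta(x^k)=0$; otherwise compute a step size $\lambda_k\in(0,1]$ and set $x^{k+1}:=x^k+\lambda_k(p(x^k)-x^k)$. Armijo step size: fix $\zeta\in(0,1)$ and $0<\omega_1<\omega_2<1$. Set $\lambda_{k_0}=1$, $\ell=0$. If $F(x^k+\lambda_{k_\ell}[p(x^k)-x^k])\preceq F(x^k)-\zeta\lambda_{k_\ell}|\theta(x^k)|e$, then set $\lambda_k:=\lambda_{k_\ell}$ and finish; otherwise choose any $\lambda_{k_{\ell+1}}\in[\omega_1\lambda_{k_\ell},\omega_2\lambda_{k_\ell}]$,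 increase $\ell$ by one and repeat the test. Counting: an evaluation of $F$ at a point counts as $m$ function evaluations (one of each $f_j$). $F$ is evaluated at $x^0$ and at every trial point $x^k+\lambda_{k_\ell}[p(x^k)-x^k]$ tested by the line search; the value $F(x^{k+1})$ at the accepted trial point is reused. The gradients $\nabla h_1,\dots,\nabla h_m$ are evaluated once each at every iterate $x^k$ at which $p(x^k)$ and $\theta(x^k)$ are computed. The count runs until the first iterate with $|\theta(x^k)|\le\varepsilon$. The $\mathcal{O}$ statements refer to $\varepsilon\to0^+$. Constants: $\Omega>0$ is a fixed number with $\Omega\ge\mathrm{diam}(\mathrm{dom}(G))$; $L=\max_{j\in\mathcal{J}}L_j$; $L_G=\max_{j\in\mathcal{J}}L_{g_j}$; $\rho=\sup\{\|\nabla h_j(x)\|: x\in\mathrm{dom}(G),\ j\in\mathcal{J}\}$; $$\gamma=\min\Big\{\frac{1}{(\rho+L_G)\Omega},\ \frac{2\omega_1(1-\zeta)}{L\Omega^2}\Big\}.$$ Moreover $f_{j^*}(x^0):=\max\{f_j(x^0): j\in\mathcal{J}\}$ and $f_{j^*}^{\inf}:=\min\{f_j^*: j\in\mathcal{J}\}$, where $f_j^*:=\inf\{f_j(x): x\in\mathrm{dom}(G)\}$.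
   Formalization: The bound on function evaluations is stated only when γεω₂ ≤ 1; for larger ε and a positive gap the printed bound is below m, although evaluating F at x^0 already costs m. All other claims are for every ε > 0. *)

(* Defs.v *)
From HB Require Import structures.
From mathcomp Require Import all_boot all_order all_algebra.
From mathcomp Require Import all_classical all_reals all_analysis.

Set Implicit Arguments.
Unset Strict Implicit.
Unset Printing Implicit Defensive.

Import Order.TTheory GRing.Theory Num.Theory.
Import numFieldNormedType.Exports.

Local Open Scope classical_set_scope.
Local Open Scope ring_scope.

(* The library norm `|v| on 'rV[R]_n is the sup norm, hence [enorm]. *)
Definition dot (R : realType) (n : nat) (u v : 'rV[R]_n) : R :=
  \sum_(i < n) u 0 i * v 0 i.

Definition enorm (R : realType) (n : nat) (v : 'rV[R]_n) : R :=
  Num.sqrt (dot v v).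

Definition ediam (R : realType) (n : nat) (A : set 'rV[R]_n) : \bar R :=
  ereal_sup [set (enorm (z.1 - z.2))%:E | z in A `*` A].

Definition grad (R : realType) (n : nat) (h : 'rV[R]_n -> R) (x : 'rV[R]_n) :
    'rV[R]_n :=
  \row_(i < n) 'D_(delta_mx 0 i) h x.

Definition continuously_differentiable (R : realType) (n : nat)
    (h : 'rV[R]_n -> R) : Prop :=
  (forall x, differentiable h x) /\ continuous (grad h).

Definition edom (R : realType) (n : nat) (g : 'rV[R]_n -> \bar R) :
    set 'rV[R]_n :=
  [set x | (g x < +oo)%E].

Definition proper_ext (R : realType) (n : nat) (g : 'rV[R]_n -> \bar R) : Prop :=
  (forall x, (-oo < g x)%E) /\ edom g !=set0.

(* For a proper g no sum below is of the form +oo - oo, and 0 * +oo = 0. *)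
Definition econvex (R : realType) (n : nat) (g : 'rV[R]_n -> \bar R) : Prop :=
  forall (x y : 'rV[R]_n) (t : R), 0 <= t <= 1 ->
    (g (t *: x + (1 - t) *: y)%R <= t%:E * g x + (1 - t)%:E * g y)%E.

Definition domG (R : realType) (m n : nat) (g : 'I_m -> 'rV[R]_n -> \bar R) :
    set 'rV[R]_n :=
  [set x | forall j, edom (g j) x].

Definition objective (R : realType) (m n : nat)
    (g : 'I_m -> 'rV[R]_n -> \bar R) (h : 'I_m -> 'rV[R]_n -> R)
    (j : 'I_m) (x : 'rV[R]_n) : \bar R :=
  (g j x + (h j x)%:E)%E.

(* The function of u minimized in the definition of theta(x). *)
Definition model (R : realType) (m n : nat)
    (g : 'I_m -> 'rV[R]_n -> \bar R) (h : 'I_m -> 'rV[R]_n -> R)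
    (x u : 'rV[R]_n) : \bar R :=
  (\big[maxe/-oo]_(j < m) (g j u - g j x + (dot (grad (h j) x) (u - x))%:E))%E.

(* Total version of the minimum; [subproblem_sol] says that it is attained. *)
Definition theta (R : realType) (m n : nat)
    (g : 'I_m -> 'rV[R]_n -> \bar R) (h : 'I_m -> 'rV[R]_n -> R)
    (x : 'rV[R]_n) : \bar R :=
  ereal_inf (range (model g h x)).

Definition subproblem_sol (R : realType) (m n : nat)
    (g : 'I_m -> 'rV[R]_n -> \bar R) (h : 'I_m -> 'rV[R]_n -> R)
    (x p : 'rV[R]_n) : Prop :=
  domG g p /\ model g h x p = theta g h x.

Definition armijo_test (R : realType) (m n : nat)
    (g : 'I_m -> 'rV[R]_n -> \bar R) (h : 'I_m -> 'rV[R]_n -> R)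
    (zeta : R) (x p : 'rV[R]_n) (lam : R) : Prop :=
  forall j : 'I_m,
    (objective g h j (x + lam *: (p - x))%R
       <= objective g h j x - (zeta * lam)%:E * `|theta g h x|)%E.

(* An execution is recorded by iterates x k, solutions p k of the subproblem at
   x k, and trial step sizes lam k l (the l-th one tried at iteration k).
   [first_accepted] says that the line search at iteration k finishes with
   lam k l, that is, after testing exactly l + 1 trial points. *)
Definition first_accepted (R : realType) (m n : nat)
    (g : 'I_m -> 'rV[R]_n -> \bar R) (h : 'I_m -> 'rV[R]_n -> R)
    (zeta : R) (x p : nat -> 'rV[R]_n) (lam : nat -> nat -> R)
    (k l : nat) : Prop :=
  armijo_test g h zeta (x k) (p k) (lam k l) /\
  (forall i, (i < l)%N -> ~ armijo_test g h zeta (x k) (p k) (lam k i)).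

(* The method reaches iteration k: no earlier iteration stopped, and every
   earlier line search finished. *)
Definition reached (R : realType) (m n : nat)
    (g : 'I_m -> 'rV[R]_n -> \bar R) (h : 'I_m -> 'rV[R]_n -> R)
    (zeta : R) (x p : nat -> 'rV[R]_n) (lam : nat -> nat -> R)
    (k : nat) : Prop :=
  forall i, (i < k)%N ->
    theta g h (x i) <> 0%E /\
    exists l, first_accepted g h zeta x p lam i l.

(* The sequences are total, but they are constrained only as far as the method
   actually runs: neither finiteness of a line search nor reaching any further
   iterate is assumed, and entries that are never computed are arbitrary. *)
Record armijo_gcg_run (R : realType) (m n : nat)
    (g : 'I_m -> 'rV[R]_n -> \bar R) (h : 'I_m -> 'rV[R]_n -> R)
    (zeta omega1 omega2 : R)
    (x p : nat -> 'rV[R]_n) (lam : nat -> nat -> R) : Prop := ArmijoGcgRun {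
  run_start : domG g (x 0%N) ;
  run_subproblem : forall k, reached g h zeta x p lam k ->
    subproblem_sol g h (x k) (p k) ;
  run_first_trial : forall k, reached g h zeta x p lam k ->
    theta g h (x k) <> 0%E -> lam k 0%N = 1 ;
  run_backtrack : forall k l, reached g h zeta x p lam k ->
    theta g h (x k) <> 0%E ->
    (forall i, (i <= l)%N -> ~ armijo_test g h zeta (x k) (p k) (lam k i)) ->
    omega1 * lam k l <= lam k l.+1 <= omega2 * lam k l ;
  run_update : forall k l, reached g h zeta x p lam k ->
    theta g h (x k) <> 0%E -> first_accepted g h zeta x p lam k l ->
    x k.+1 = x k + lam k l *: (p k - x k) }.

(* Evaluations made up to the computation of theta(x K), when the line search
   at each iteration k < K tests ell k + 1 trial points: F is evaluated at x 0
   and at all trial points, the gradients at x 0, ..., x K. *)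
Definition function_evals (m K : nat) (ell : nat -> nat) : nat :=
  (m * (1 + \sum_(k < K) (ell k).+1))%N.

Definition gradient_evals (m K : nat) : nat := (m * K.+1)%N.

Definition rho (R : realType) (m n : nat)
    (g : 'I_m -> 'rV[R]_n -> \bar R) (h : 'I_m -> 'rV[R]_n -> R) : R :=
  sup [set r | exists (j : 'I_m) (x : 'rV[R]_n),
                 domG g x /\ r = enorm (grad (h j) x)].

(* Maximum of finitely many positive numbers. *)
Definition max_const (R : realType) (m : nat) (L : 'I_m -> R) : R :=
  \big[Num.max/0]_(j < m) L j.

Definition gamma (R : realType) (m n : nat)
    (g : 'I_m -> 'rV[R]_n -> \bar R) (h : 'I_m -> 'rV[R]_n -> R)
    (Lg L : 'I_m -> R) (Omega zeta omega1 : R) : R :=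
  Num.min (1 / ((rho g h + max_const Lg) * Omega))
          (2 * omega1 * (1 - zeta) / (max_const L * Omega ^+ 2)).

Definition f_max (R : realType) (m n : nat)
    (g : 'I_m -> 'rV[R]_n -> \bar R) (h : 'I_m -> 'rV[R]_n -> R)
    (x0 : 'rV[R]_n) : \bar R :=
  \big[maxe/-oo%E]_(j < m) objective g h j x0.

Definition f_inf (R : realType) (m n : nat)
    (g : 'I_m -> 'rV[R]_n -> \bar R) (h : 'I_m -> 'rV[R]_n -> R) : \bar R :=
  \big[mine/+oo%E]_(j < m) ereal_inf [set objective g h j x | x in domG g].

(* Both terms are finite when x0 is in the nonempty compact set domG g. *)
Definition f_gap (R : realType) (m n : nat)
    (g : 'I_m -> 'rV[R]_n -> \bar R) (h : 'I_m -> 'rV[R]_n -> R)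
    (x0 : 'rV[R]_n) : R :=
  fine (f_max g h x0) - fine (f_inf g h).

Definition function_bound (R : realType) (m : nat)
    (zeta omega2 gam gap eps : R) : R :=
  m%:R * ((1 + ln (gam * eps) / ln omega2) * (gap / (zeta * gam))
            * (1 / eps ^+ 2) + 1).

Definition gradient_bound (R : realType) (m : nat)
    (zeta gam gap eps : R) : R :=
  m%:R * (gap / (zeta * gam) * (1 / eps ^+ 2) + 1).

(* Main.v *)
Require Import Defs.
From HB Require Import structures.
From mathcomp Require Import all_boot all_order all_algebra.
From mathcomp Require Import all_classical all_reals all_analysis.
From mathcomp Require Import ring lra.

Set Implicit Arguments.
Unset Strict Implicit.
Unset Printing Implicit Defensive.

Import Order.TTheory GRing.Theory Num.Theory.
Import numFieldNormedType.Exports.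

Local Open Scope classical_set_scope.
Local Open Scope ring_scope.

(** Write t for |theta(x)|. Two estimates on t drive everything. First, a step
    of length a towards p(x) changes every objective by at most
      - a t + (L / 2) (a Omega)^2,
    by convexity of g_j on the segment and by the quadratic upper bound that a
    Lipschitz gradient gives for h_j ([descent], [fval_segment]). Hence the
    Armijo test, which asks only for a decrease of zeta a t, succeeds as soon as
    a <= 2 (1 - zeta) t / (L Omega^2), a quantity called [safe x] below
    ([armijo_small_step]). Secondly, t <= (rho + L_G) Omega, because each term
    of the model varies by at most that much over the domain
    ([subproblem_value]).

    A backtracking search whose trials shrink by factors between omega1 and
    omega2 therefore stops, and the accepted step is either 1 or at least
    omega1 times the safe length ([trial_lower]). The constant gamma is chosen
    such that gamma t lies below both alternatives, so that every accepted step
    a satisfies a >= gamma t ([accepted_step]), and every component of F then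
    drops by at least zeta gamma t^2 ([fval_next]). While t > eps the total
    drop is bounded by the gap between the largest initial value and the
    smallest infimum, so at most gap / (zeta gamma eps^2) iterations are
    possible ([iteration_bound]); this yields an iterate with t <= eps and
    the gradient count.

    For the function count, the trial number l (from 0) satisfies
    a <= omega2^l. Together with a >= gamma t > gamma eps, taking logarithms
    gives l <= ln (gamma eps) / ln omega2 ([expr_ge_ln]), which bounds the
    number l + 1 of trial points at each iteration. *)

(** * Euclidean inner product and norm *)

Section EuclideanNorm.
Context (R : realType) (n : nat).
Implicit Types (u v w : 'rV[R]_n) (a : R).

Lemma dotC u v : dot u v = dot v u.
Proof. by apply: eq_bigr => i _; rewrite mulrC. Qed.

Lemma dotDr u v w : dot u (v + w) = dot u v + dot u w.
Proof. by rewrite /dot -big_split; apply: eq_bigr => i _; rewrite mxE mulrDr. Qed.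

Lemma dotZr u a v : dot u (a *: v) = a * dot u v.
Proof. by rewrite /dot mulr_sumr; apply: eq_bigr => i _; rewrite mxE mulrCA. Qed.

Lemma dotBr u v w : dot u (v - w) = dot u v - dot u w.
Proof. by rewrite dotDr -scaleN1r dotZr mulN1r. Qed.

Lemma dotBl u v w : dot (u - v) w = dot u w - dot v w.
Proof. by rewrite !(dotC _ w) dotBr. Qed.

Lemma dot_ge0 u : 0 <= dot u u.
Proof. by apply: sumr_ge0 => i _; rewrite -expr2 sqr_ge0. Qed.

Lemma enorm_ge0 u : 0 <= enorm u.
Proof. exact: sqrtr_ge0. Qed.

Lemma sqr_enorm u : enorm u ^+ 2 = dot u u.
Proof. by rewrite sqr_sqrtr // dot_ge0. Qed.

Lemma enormZ a u : enorm (a *: u) = `|a| * enorm u.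
Proof.
by rewrite /enorm dotZr dotC dotZr mulrA -expr2 sqrtrM ?sqr_ge0 // sqrtr_sqr.
Qed.

(** Expanding |  |v| u - |u| v  |^2 >= 0 gives the inequality multiplied by
    |u| |v|; that factor cancels unless one of the vectors is zero. *)
Lemma cauchy_schwarz u v : dot u v <= enorm u * enorm v.
Proof.
have eu := enorm_ge0 u; have ev := enorm_ge0 v.
have := dot_ge0 (enorm v *: u - enorm u *: v).
rewrite dotBr !dotBl !dotZr !(dotC (_ *: _)) !dotZr -!sqr_enorm (dotC v u) => H.
have {}H : enorm u * enorm v * dot u v <= (enorm u * enorm v) ^+ 2 by nra.
have [uv0|] := ltrP 0 (enorm u * enorm v); first by rewrite expr2 ler_pM2l in H.
move=> uv0.
(* One of the vectors has norm zero; then every entry of it vanishes. *)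
have zero w z : enorm w = 0 -> dot w z = 0.
  move=> w0; apply: big1 => i _.
  have ww0 : \sum_(j < n) w 0 j * w 0 j = 0.
    by rewrite -[LHS]/(dot w w) -sqr_enorm w0 expr0n.
  have ge0 j : true -> 0 <= w 0 j * w 0 j by rewrite -expr2 sqr_ge0.
  have /eqP := psumr_eq0P ge0 ww0 (i := i) erefl.
  by rewrite mulf_eq0 orbb => /eqP ->; rewrite mul0r.
have /eqP : enorm u * enorm v = 0 by apply/le_anti; rewrite uv0 mulr_ge0.
rewrite mulf_eq0 => /orP[/eqP u0|/eqP v0]; first by rewrite zero // u0 mul0r.
by rewrite dotC zero // v0 mulr0.
Qed.

Lemma ler_enormD u v : enorm (u + v) <= enorm u + enorm v.
Proof.
rewrite -(@ler_pXn2r _ 2) ?nnegrE ?addr_ge0 ?enorm_ge0 // sqr_enorm.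
rewrite dotDr !(dotC (u + v)) !dotDr -!sqr_enorm (dotC v u).
have := cauchy_schwarz u v; nra.
Qed.

End EuclideanNorm.

(** * Quadratic upper bound for a function with Lipschitz gradient *)

Section DescentLemma.
Context (R : realType) (n : nat) (h : 'rV[R]_n -> R).
Context (h_diff : forall y, differentiable h y).

(** The gradient is defined by partial derivatives; differentiability is what
    makes it represent all directional derivatives. *)
Lemma derive_grad y d : 'D_d h y = dot (grad h y) d.
Proof.
rewrite deriveE // [in LHS](row_sum_delta d) linear_sum; apply: eq_bigr => i _.
by rewrite linearZ mxE deriveE //= mulrC.
Qed.

Lemma is_derive_line y d (t : R) :
  is_derive t 1 (fun s : R => h (s *: d + y)) (dot (grad h (t *: d + y)) d).
Proof.
rewrite -derive_grad.
have e : (fun s : R => s^-1 *: (((fun s => h (s *: d + y)) \o shift t) (s *: 1)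
           - h (t *: d + y))) =
  (fun s : R => s^-1 *: ((h \o shift (t *: d + y)) (s *: d)
           - h (t *: d + y))).
  by apply/funext => s /=; rewrite [s%:A]mulr1 scalerDl addrA.
apply: DeriveDef; last by rewrite /derive e.
by rewrite /derivable e; exact: diff_derivable.
Qed.

(** With d = y - x, the function
      s |-> h (x + s d) - s <grad h x, d> - (L / 2) s^2 |d|^2
    has derivative <grad h (x + s d) - grad h x, d> - L s |d|^2, which is
    nonpositive for s >= 0 by Cauchy-Schwarz and the Lipschitz condition. The
    mean value theorem on [0, 1] concludes. *)
Lemma descent (L : R) x y :
  (forall u v, enorm (grad h u - grad h v) <= L * enorm (u - v)) ->
  h y <= h x + dot (grad h x) (y - x) + L / 2 * enorm (y - x) ^+ 2.
Proof.
move=> h_lip; set d := y - x; set c := dot (grad h x) d; set q := L / 2 * _.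
pose psi (s : R) := h (s *: d + x) - (c * s + q * (s * s)).
pose dpsi (s : R) := dot (grad h (s *: d + x)) d - (c + q * (s + s)).
have psi' (s : R) : is_derive s (1 : R) psi (dpsi s).
  have H := is_derive_line x d s.
  rewrite /psi /dpsi; apply: is_deriveB.
  apply: is_derive_eq.
  by rewrite /GRing.scale/=; ring.
have [s /[!in_itv]/= /andP[s0 s1] E] : exists2 s, s \in `]0, 1[ &
    psi 1 - psi 0 = dpsi s * (1 - 0).
  apply: (@MVT _ psi dpsi 0 1) => //.
  apply: derivable_within_continuous => s _.
  by have [] := psi' s.
have dpsi_le0 : dpsi s <= 0.
  rewrite /dpsi /c.
  have := cauchy_schwarz (grad h (s *: d + x) - grad h x) d.
  rewrite dotBl.
  have := ler_wpM2r (enorm_ge0 d) (h_lip (s *: d + x) x).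
  rewrite addrK enormZ gtr0_norm // /q expr2; nra.
move: E dpsi_le0; rewrite /psi scale1r scale0r add0r /d subrK; lra.
Qed.

End DescentLemma.

(** * Backtracking line search *)

(** The search is studied for an arbitrary acceptance predicate, of which only
    one thing is known: steps in [0, 1] that do not exceed s are accepted. *)
Section Backtracking.
Context (R : realType) (accept : R -> Prop) (lam : nat -> R) (w1 w2 s : R).
Context (w1_gt0 : 0 < w1) (w12 : w1 < w2) (w2_lt1 : w2 < 1) (s_gt0 : 0 < s).
Context (first_trial : lam 0%N = 1).
Context (backtrack : forall l, (forall i, (i <= l)%N -> ~ accept (lam i)) ->
  w1 * lam l <= lam l.+1 <= w2 * lam l).
Context (accept_small : forall a, 0 <= a <= 1 -> a <= s -> accept a).

Lemma trial_geometric l :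
  (forall i, (i < l)%N -> ~ accept (lam i)) -> 0 < lam l <= w2 ^+ l.
Proof.
elim: l => [|l IHl] rej; first by rewrite first_trial expr0 ltr01 lexx.
have /andP[l0 lw] : 0 < lam l <= w2 ^+ l.
  by apply: IHl => i il; apply: rej; rewrite ltnS ltnW.
have /andP[lo up] := backtrack rej.
rewrite (lt_le_trans _ lo) ?mulr_gt0 //= exprS (le_trans up) //.
by rewrite ler_pM2l // (lt_trans w1_gt0).
Qed.

Lemma trial_le1 l : (forall i, (i < l)%N -> ~ accept (lam i)) -> lam l <= 1.
Proof.
move=> /trial_geometric /andP[_ /le_trans]; apply.
by apply: exprn_ile1; [exact: ltW (lt_trans w1_gt0 w12) | exact: ltW].
Qed.

(** For l > 0 the preceding trial was rejected, hence longer than s, and one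
    backtracking step multiplies it by at least w1. *)
Lemma trial_lower l :
  (forall i, (i < l)%N -> ~ accept (lam i)) -> Num.min 1 (w1 * s) <= lam l.
Proof.
case: l => [|l] rej; first by rewrite first_trial ge_min lexx.
have rejl i : (i < l)%N -> ~ accept (lam i) by move=> il; apply: rej; apply: ltnW.
have /andP[lo _] := backtrack rej; rewrite ge_min; apply/orP; right.
apply: le_trans lo; rewrite ler_pM2l // leNgt; apply/negP => ls.
apply: (rej l (leqnn _)); apply: accept_small; last exact: ltW.
by rewrite trial_le1 // andbT ltW //; have /andP[] := trial_geometric rejl.
Qed.

(** If every trial were rejected, the trials would tend to 0 geometrically and
    fall below s, where they are accepted. *)
Lemma backtracking_terminates :
  exists l, accept (lam l) /\ forall i, (i < l)%N -> ~ accept (lam i).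
Proof.
have [l al] : exists l, `[< accept (lam l) >].
  apply: contrapT => none.
  have rej l i : (i < l)%N -> ~ accept (lam i).
    by move=> _ ai; apply: none; exists i; apply/asboolP.
  have w2_norm : `|w2| < 1 by rewrite gtr0_norm // (lt_trans w1_gt0).
  have /cvgrPdist_lt /(_ _ s_gt0) [N _ /(_ N (leqnn N)) /=] := cvg_expr w2_norm.
  rewrite sub0r normrN => wN.
  have /andP[l0 lw] := trial_geometric (rej N).
  apply: (rej N.+1 N (leqnn _)); apply: accept_small.
    by rewrite ltW //= (trial_le1 (rej N)).
  exact: le_trans lw (le_trans (ler_norm _) (ltW wN)).
pose Q l := `[< accept (lam l) >].
have exQ : exists l, Q l by exists l.
(* The search stops at the first accepted trial, hence the minimal index. *)
case: (ex_minnP exQ) => k /asboolP ak min_k; exists k; split=> // i ik /asboolP ai.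
by have := min_k i ai; rewrite leqNgt ik.
Qed.

End Backtracking.

Lemma expr_ge_ln (R : realType) (w v : R) l :
  0 < w < 1 -> 0 < v -> v <= w ^+ l -> l%:R <= ln v / ln w.
Proof.
move=> w01 v0 vw; have lw := ln_lt0 w01; have /andP[w0 _] := w01.
by rewrite ler_ndivlMr // mulr_natl -lnXn // ler_ln ?posrE // exprn_gt0.
Qed.

(** * Estimates on the domain *)

Section MaxConst.
Context (R : realType) (m : nat) (L : 'I_m -> R).

Lemma le_max_const j : L j <= max_const L.
Proof. exact: le_bigmax. Qed.

Lemma max_const_gt0 : (0 < m)%N -> (forall j, 0 < L j) -> 0 < max_const L.
Proof.
by move=> m_gt0 L_gt0; apply: lt_le_trans (le_max_const (Ordinal m_gt0)).
Qed.

End MaxConst.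

Section Problem.
Context (R : realType) (m n : nat) (m_gt0 : (0 < m)%N).
Context (g : 'I_m -> 'rV[R]_n -> \bar R) (h : 'I_m -> 'rV[R]_n -> R).
Context (h_diff : forall j y, differentiable (h j) y).
Context (g_proper : forall j, proper_ext (g j)).
Context (g_convex : forall j, econvex (g j)).
Context (Lg : 'I_m -> R) (Lg_gt0 : forall j, 0 < Lg j).
Context (g_lip : forall j x y, edom (g j) x -> edom (g j) y ->
     (`|g j x - g j y| <= (Lg j * enorm (x - y)%R)%:E)%E).
Context (L : 'I_m -> R) (L_gt0 : forall j, 0 < L j).
Context (h_lip : forall j x y,
     enorm (grad (h j) x - grad (h j) y) <= L j * enorm (x - y)).
Context (Omega : R) (Omega_gt0 : 0 < Omega).
Context (Omega_diam : (ediam (domG g) <= Omega%:E)%E).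
Implicit Types (x y u p : 'rV[R]_n) (j : 'I_m).

Let LG := max_const Lg.
Let LH := max_const L.

(** On domG every g_j and hence every f_j is finite; the estimates are carried
    out on these real values, and [g_fin] and [objectiveE] translate back. *)
Definition gval j x : R := fine (g j x).
Definition fval j x : R := gval j x + h j x.

Lemma g_fin j x : domG g x -> g j x = (gval j x)%:E.
Proof.
by move=> dx; rewrite fineK // fin_real // (g_proper j).1; exact: dx.
Qed.

Lemma objectiveE j x : domG g x -> objective g h j x = (fval j x)%:E.
Proof. by move=> dx; rewrite /objective g_fin. Qed.

Lemma enorm_domG x y : domG g x -> domG g y -> enorm (x - y) <= Omega.
Proof.
move=> dx dy; rewrite -lee_fin; apply: le_trans Omega_diam.
by apply: ereal_sup_ubound; exists (x, y).
Qed.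

Lemma gval_lip j x y : domG g x -> domG g y -> gval j x - gval j y <= LG * Omega.
Proof.
move=> dx dy; have := g_lip (dx j) (dy j).
rewrite !g_fin // -EFinB abse_EFin lee_fin => H.
apply: le_trans (ler_norm _) (le_trans H _).
by rewrite ler_pM ?enorm_ge0 ?enorm_domG ?le_max_const // ltW.
Qed.

Lemma segmentE x p (a : R) : x + a *: (p - x) = a *: p + (1 - a) *: x.
Proof. by rewrite scalerBr scalerBl scale1r [LHS]addrCA [x - _]addrC. Qed.

Lemma g_segment j x p (a : R) : domG g x -> domG g p -> 0 <= a <= 1 ->
  (g j (x + a *: (p - x))%R <= (gval j x + a * (gval j p - gval j x))%:E)%E.
Proof.
move=> dx dp a01; rewrite segmentE.
apply: le_trans (g_convex j p x a01) _.
by rewrite !g_fin // -!EFinM -EFinD lee_fin; lra.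
Qed.

Lemma domG_segment x p (a : R) : domG g x -> domG g p -> 0 <= a <= 1 ->
  domG g (x + a *: (p - x)).
Proof.
by move=> dx dp a01 j; apply: le_lt_trans (g_segment j dx dp a01) _; rewrite ltry.
Qed.

Lemma gval_segment j x p (a : R) : domG g x -> domG g p -> 0 <= a <= 1 ->
  gval j (x + a *: (p - x)) <= gval j x + a * (gval j p - gval j x).
Proof.
move=> dx dp a01; rewrite -lee_fin -g_fin; first exact: g_segment.
exact: domG_segment.
Qed.

(** A supremum in the reals bounds its set only if that set is bounded above.
    Here a Lipschitz gradient on a set of diameter at most Omega stays within
    L Omega of its value at the given point x. *)
Lemma grad_le_rho j x : domG g x -> enorm (grad (h j) x) <= rho g h.
Proof.
move=> dx; apply: ub_le_sup; last by exists j, x.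
exists (\big[Num.max/0]_(i < m) enorm (grad (h i) x) + LH * Omega).
move=> _ [i [y [dy ->]]].
rewrite -[grad (h i) y](subrK (grad (h i) x)) addrC.
apply: le_trans (ler_enormD _ _) _; apply: lerD; first exact: (@le_bigmax _ _ _ 0).
apply: le_trans (h_lip _ _ _) _.
by rewrite ler_pM ?enorm_ge0 ?enorm_domG ?le_max_const // ltW.
Qed.

Lemma rho_ge0 x : domG g x -> 0 <= rho g h.
Proof. by move=> /(grad_le_rho (Ordinal m_gt0)); apply: le_trans (enorm_ge0 _). Qed.

Lemma dot_grad_le j x u v : domG g x -> domG g u -> domG g v ->
  dot (grad (h j) x) (u - v) <= rho g h * Omega.
Proof.
move=> dx du dv; apply: le_trans (cauchy_schwarz _ _) _.
by rewrite ler_pM ?enorm_ge0 ?enorm_domG ?grad_le_rho.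
Qed.

Lemma h_descent j x y : domG g x -> domG g y ->
  forall a : R, 0 <= a ->
  h j (x + a *: (y - x)) <=
    h j x + a * dot (grad (h j) x) (y - x) + LH / 2 * (a * Omega) ^+ 2.
Proof.
move=> dx dy a a0.
have := descent (h_diff j) x (x + a *: (y - x)) (@h_lip j).
rewrite [x + _ - x]addrC addKr dotZr enormZ (ger0_norm a0) => /le_trans; apply.
rewrite lerD2l ler_pM //.
- by rewrite divr_ge0 // ltW.
- exact: sqr_ge0.
- by rewrite ler_pM2r ?invr_gt0 // le_max_const.
have ex := enorm_domG dy dx.
rewrite ler_pXn2r ?nnegrE ?mulr_ge0 ?enorm_ge0 //; last exact: ltW.
exact: ler_wpM2l.
Qed.

(** The absolute value of theta as a real number; [abs_theta] below shows that
    no information is lost when the subproblem has a solution. *)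
Definition tau x : R := `|fine (theta g h x)|.

(** theta is at most the model at u = x, which is 0, and at least any single
    term of the model at p, which is finite and bounded below by the Lipschitz
    constants. The last clause bounds each term by the maximum. *)
Lemma subproblem_value x p : domG g x -> subproblem_sol g h x p ->
  [/\ theta g h x = (- tau x)%:E, tau x <= (rho g h + LG) * Omega &
    forall j, gval j p - gval j x + dot (grad (h j) x) (p - x) <= - tau x].
Proof.
move=> dx [dp sol].
have le_theta j :
    ((gval j p - gval j x + dot (grad (h j) x) (p - x))%:E <= theta g h x)%E.
  rewrite -sol EFinD EFinB -!g_fin //.
  exact: (le_bigmax -oo%E (fun j => g j p - g j x +
     (dot (grad (h j) x) (p - x))%:E)%E).
have theta_le0 : (theta g h x <= 0)%E.
  apply: le_trans (ereal_inf_lbound _) _; first by exists x.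
  apply: bigmax_le => [|j _]; first exact: leNye.
  by rewrite g_fin // -EFinB -EFinD lee_fin dotBr !subrr addr0.
have theta_fin : theta g h x \is a fin_num.
  rewrite fin_numElt (lt_le_trans _ (le_theta (Ordinal m_gt0))) ?ltNyr //.
  by rewrite (le_lt_trans theta_le0) // ltry.
have tE : theta g h x = (- tau x)%:E.
  by rewrite /tau ler0_norm ?opprK ?fineK // -lee_fin fineK.
split=> // [|j]; last by rewrite -lee_fin -tE.
have := le_theta (Ordinal m_gt0); rewrite tE lee_fin.
have := gval_lip (Ordinal m_gt0) dx dp.
have := dot_grad_le (Ordinal m_gt0) dx dx dp.
rewrite !dotBr; lra.
Qed.

(** The convex parts contribute a linear decrease along the segment, the smooth
    parts a linear decrease plus a quadratic error; the linear parts together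
    form one term of the model. *)
Lemma fval_segment j x p (a t : R) : domG g x -> domG g p -> 0 <= a <= 1 ->
  gval j p - gval j x + dot (grad (h j) x) (p - x) <= - t ->
  fval j (x + a *: (p - x)) <= fval j x - a * t + LH / 2 * (a * Omega) ^+ 2.
Proof.
move=> dx dp a01 le_t; have /andP[a0 _] := a01.
have := gval_segment j dx dp a01; have := h_descent j dx dp a0.
have := ler_wpM2l a0 le_t; rewrite /fval; lra.
Qed.

(** Needed for the infima to be finite. It follows from the descent inequality
    read from y towards x, so that only the upper bound on h_j is used. *)
Lemma fval_lower j x y : domG g x -> domG g y ->
  fval j x - (LG * Omega + rho g h * Omega + LH / 2 * Omega ^+ 2) <= fval j y.
Proof.
move=> dx dy; have := gval_lip j dx dy; have := dot_grad_le j dy dx dy.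
have := h_descent j dy dx ler01.
rewrite scale1r !mul1r [y + _]addrC subrK /fval; lra.
Qed.

Lemma f_max_fin x : domG g x ->
  f_max g h x = (fine (f_max g h x))%:E.
Proof.
move=> dx; rewrite fineK // fin_numElt; apply/andP; split.
  apply: lt_le_trans (le_bigmax _ _ (Ordinal m_gt0)).
  by rewrite objectiveE // ltNyr.
apply: le_lt_trans (ltry (\sum_j `|fval j x|)).
apply: bigmax_le => [|j _]; first exact: leNye.
rewrite objectiveE // lee_fin (bigD1 j) //= (le_trans (ler_norm _)) //.
by rewrite lerDl sumr_ge0.
Qed.

Lemma fval_le_max j x : domG g x -> fval j x <= fine (f_max g h x).
Proof.
move=> dx; rewrite -lee_fin -f_max_fin // -objectiveE //; exact: le_bigmax.
Qed.

Lemma f_inf_le j y : domG g y -> (f_inf g h <= (fval j y)%:E)%E.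
Proof.
move=> dy; apply: le_trans (bigmin_le _ j _) _.
by apply: ereal_inf_lbound; exists y; rewrite ?objectiveE.
Qed.

Lemma f_inf_le_fval j y : domG g y -> fine (f_inf g h) <= fval j y.
Proof.
move=> dy; rewrite -lee_fin fineK ?f_inf_le // fin_numElt; apply/andP; split; last first.
  by apply: le_lt_trans (f_inf_le j dy) (ltry _).
set C := LG * Omega + rho g h * Omega + LH / 2 * Omega ^+ 2.
apply: lt_le_trans (ltNyr (- \sum_i `|fval i y - C|)) _.
apply: le_bigmin => [|i _]; first exact: leey.
apply: le_ereal_inf_tmp => _ [z dz <-]; rewrite objectiveE // lee_fin.
apply: le_trans (fval_lower i dy dz); rewrite lerNl.
rewrite (bigD1 i) //= -normrN (le_trans (ler_norm _)) //.
by rewrite lerDl sumr_ge0.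
Qed.

Lemma fval_gap j x y : domG g x -> domG g y ->
  fval j x - fval j y <= f_gap g h x.
Proof. by move=> dx dy; rewrite lerB ?fval_le_max ?f_inf_le_fval. Qed.


(** * Step sizes accepted by the Armijo test *)

Context (zeta w1 w2 : R) (zeta01 : 0 < zeta < 1).
Context (w1_gt0 : 0 < w1) (w12 : w1 < w2) (w2_lt1 : w2 < 1).

Let gam := gamma g h Lg L Omega zeta w1.
Let safe x := 2 * (1 - zeta) / (LH * Omega ^+ 2) * tau x.

Lemma tau_ge0 x : 0 <= tau x. Proof. exact: normr_ge0. Qed.

Lemma LH_gt0 : 0 < LH. Proof. exact: max_const_gt0. Qed.

Lemma abs_theta x p : domG g x -> subproblem_sol g h x p ->
  (`|theta g h x| = (tau x)%:E)%E.
Proof.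
move=> dx /(subproblem_value dx) [-> _ _].
by rewrite abse_EFin normrN ger0_norm ?tau_ge0.
Qed.

Lemma armijo_testE x p (a : R) : domG g x -> subproblem_sol g h x p ->
  0 <= a <= 1 -> armijo_test g h zeta x p a <->
  forall j, fval j (x + a *: (p - x)) <= fval j x - zeta * a * tau x.
Proof.
move=> dx sol a01; have da := domG_segment dx sol.1 a01.
by split=> test j; have := test j;
  rewrite (abs_theta dx sol) !objectiveE // -EFinM -EFinB lee_fin.
Qed.

(** The quadratic error (L / 2) (a Omega)^2 is absorbed by the part
    (1 - zeta) a t of the linear decrease that the test does not ask for. *)
Lemma armijo_small_step x p (a : R) : domG g x -> subproblem_sol g h x p ->
  0 <= a <= 1 -> a <= safe x -> armijo_test g h zeta x p a.
Proof.
move=> dx sol a01 a_small; apply/armijo_testE => // j.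
have [_ _ /(_ j) le_t] := subproblem_value dx sol.
have := fval_segment dx sol.1 a01 le_t.
have LO : 0 < LH * Omega ^+ 2 by rewrite mulr_gt0 ?exprn_gt0 ?LH_gt0.
move: a_small; rewrite /safe mulrAC ler_pdivlMr // => a_small.
have /andP[a0 _] := a01.
have := ler_wpM2l a0 a_small; rewrite exprMn; lra.
Qed.

Lemma gamma_gt0 x : domG g x -> 0 < gam.
Proof.
move=> dx; have /andP[_ z1] := zeta01; have rho0 := rho_ge0 dx.
have LG0 : 0 < LG by exact: max_const_gt0.
have D0 : 0 < rho g h + LG by rewrite ltr_wpDl.
by rewrite lt_min; apply/andP; split;
  rewrite divr_gt0 ?mulr_gt0 ?subr_gt0 ?exprn_gt0 ?LH_gt0.
Qed.

(** This and [gamma_tau_le_safe] explain the two terms of the minimum that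
    defines gamma: the first keeps gamma t below the initial trial 1, the second
    below the shortest step that backtracking can end with. *)
Lemma gamma_tau_le1 x p : domG g x -> subproblem_sol g h x p ->
  gam * tau x <= 1.
Proof.
move=> dx /(subproblem_value dx) [_ le_t _]; have rho0 := rho_ge0 dx.
have LG0 : 0 < LG by exact: max_const_gt0.
have D0 : 0 < (rho g h + LG) * Omega by rewrite mulr_gt0 ?ltr_wpDl.
apply: (@le_trans _ _ (1 / ((rho g h + LG) * Omega) * tau x)).
  by rewrite ler_wpM2r ?tau_ge0 // ge_min lexx.
by rewrite mulrAC mul1r ler_pdivrMr // mul1r.
Qed.

Lemma gamma_tau_le_safe x : gam * tau x <= w1 * safe x.
Proof.
have -> : w1 * safe x = 2 * w1 * (1 - zeta) / (LH * Omega ^+ 2) * tau x.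
  by rewrite /safe; lra.
by rewrite ler_wpM2r ?tau_ge0 // ge_min lexx orbT.
Qed.

(** * Decrease along a run and number of iterations *)

Context (x p : nat -> 'rV[R]_n) (lam : nat -> nat -> R).
Context (run : armijo_gcg_run g h zeta w1 w2 x p lam).

(** One iteration at which the method does not stop. That x k lies in domG is
    an assumption here because it is proved from [domG_next] by induction. *)
Section Iteration.
Context (k : nat) (reach : reached g h zeta x p lam k) (dx : domG g (x k)).
Context (theta_neq0 : theta g h (x k) <> 0%E).

Let sol : subproblem_sol g h (x k) (p k). Proof. exact: (run_subproblem run). Qed.

Lemma tau_gt0 : 0 < tau (x k).
Proof.
rewrite lt_def tau_ge0 andbT; apply/eqP => t0; apply: theta_neq0.
by have [-> _ _] := subproblem_value dx sol; rewrite t0 oppr0.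
Qed.

Lemma safe_gt0 : 0 < safe (x k).
Proof.
have /andP[_ z1] := zeta01.
by rewrite mulr_gt0 ?tau_gt0 // divr_gt0 ?mulr_gt0 ?subr_gt0 ?exprn_gt0 ?LH_gt0.
Qed.

Lemma line_search_finishes : exists l, first_accepted g h zeta x p lam k l.
Proof.
apply: (@backtracking_terminates _ (armijo_test g h zeta (x k) (p k)) (lam k)
  w1 w2 (safe (x k))) => //.
- exact: safe_gt0.
- exact: (run_first_trial run).
- by move=> l; apply: (run_backtrack run).
- by move=> a; apply: armijo_small_step.
Qed.

Context (l : nat) (acc : first_accepted g h zeta x p lam k l).

Lemma accepted_step : [/\ 0 <= lam k l <= 1, gam * tau (x k) <= lam k l &
  lam k l <= w2 ^+ l].
Proof.
have [_ rej] := acc.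
have first := run_first_trial run reach theta_neq0.
have back l' := @run_backtrack _ _ _ _ _ _ _ _ _ _ _ run k l' reach theta_neq0.
have /andP[l0 lw] := trial_geometric w1_gt0 w12 first back rej.
have l1 := trial_le1 w1_gt0 w12 w2_lt1 first back rej.
split=> //; first by rewrite ltW.
apply: le_trans (trial_lower w1_gt0 w12 w2_lt1 first back
  (fun a => @armijo_small_step _ _ a dx sol) rej).
by rewrite le_min gamma_tau_le_safe (gamma_tau_le1 dx sol).
Qed.

Lemma domG_next : domG g (x k.+1).
Proof.
have [l01 _ _] := accepted_step.
rewrite (run_update run reach theta_neq0 acc).
exact: (domG_segment dx sol.1 l01).
Qed.

Lemma fval_next j :
  fval j (x k.+1) <= fval j (x k) - zeta * gam * tau (x k) ^+ 2.
Proof.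
have [l01 gl _] := accepted_step; have [test _] := acc.
have /andP[z0 _] := zeta01.
rewrite (run_update run reach theta_neq0 acc).
have := (armijo_testE dx sol l01).1 test j.
have := ler_wpM2r (tau_ge0 (x k)) (ler_wpM2l (ltW z0) gl).
lra.
Qed.

End Iteration.

Lemma reached_prefix k : reached g h zeta x p lam k.+1 -> reached g h zeta x p lam k.
Proof. by move=> reach i ik; apply: reach; apply: ltnW. Qed.

Lemma reached_domG k : reached g h zeta x p lam k -> domG g (x k).
Proof.
elim: k => [_|k IHk reach]; first exact: (run_start run).
have [neq0 [l acc]] := reach k (leqnn _).
have reach' := reached_prefix reach.
exact: (domG_next reach' (IHk reach') neq0 acc).
Qed.

(** Telescoping [fval_next] for one fixed component of F, here the first one. *)
Lemma iteration_bound (eps : R) K : 0 < eps ->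
  reached g h zeta x p lam K -> (forall k, (k < K)%N -> eps < tau (x k)) ->
  K%:R <= f_gap g h (x 0%N) / (zeta * gam) * (1 / eps ^+ 2).
Proof.
move=> eps0 reach big; pose j0 := Ordinal m_gt0.
have d0 : domG g (x 0%N) by exact: (run_start run).
have gam0 := gamma_gt0 d0; have /andP[z0 _] := zeta01.
have step k : (k <= K)%N ->
    k%:R * (zeta * gam * eps ^+ 2) <= fval j0 (x 0%N) - fval j0 (x k).
  elim: k => [_|k IHk kK]; first by rewrite mul0r subrr.
  have reachk : reached g h zeta x p lam k.
    by move=> i ik; apply: reach; apply: ltn_trans kK.
  have [neq0 [l acc]] := reach k kK.
  have := fval_next reachk (reached_domG reachk) neq0 acc j0.
  have : zeta * gam * eps ^+ 2 <= zeta * gam * tau (x k) ^+ 2.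
    rewrite ler_pM2l ?mulr_gt0 // ler_pXn2r ?nnegrE ?tau_ge0 // ltW //.
    exact: big.
  have := IHk (ltnW kK); rewrite -natr1; lra.
have c0 : 0 < zeta * gam * eps ^+ 2 by rewrite !mulr_gt0 ?exprn_gt0.
rewrite mulrA mulr1 -mulrA -invfM ler_pdivlMr //.
apply: le_trans (step K (leqnn _)) _.
exact: (fval_gap _ d0 (reached_domG reach)).
Qed.

(** If the tolerance were never met, theta would never vanish, every line search
    would finish and the method would reach every iteration, which contradicts
    [iteration_bound]. *)
Lemma stopping_iteration (eps : R) : 0 < eps -> exists K,
  [/\ reached g h zeta x p lam K, forall k, (k < K)%N -> eps < tau (x k) &
      tau (x K) <= eps].
Proof.
move=> eps0.
pose good K := reached g h zeta x p lam K /\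
  forall k, (k < K)%N -> eps < tau (x k).
apply: contrapT => none.
have all_good K : good K.
  elim: K => [|K [reach big]]; first by split.
  have dx := reached_domG reach.
  have bigK : eps < tau (x K).
    by rewrite ltNge; apply/negP => small; apply: none; exists K.
  have neq0 : theta g h (x K) <> 0%E.
    move=> t0; move: bigK; rewrite /tau t0 normr0 => /(lt_trans eps0).
    by rewrite ltxx.
  split=> k; rewrite ltnS leq_eqVlt => /orP[/eqP->|]; [|exact: reach| |exact: big].
    by split=> //; exact: line_search_finishes.
  by [].
have [] := all_good (Num.truncn (f_gap g h (x 0%N) / (zeta * gam) * (1 / eps ^+ 2))).+1.
move=> reach big; have := iteration_bound eps0 reach big.
by rewrite leNgt truncnS_gt.
Qed.

Lemma run_gamma_gt0 : 0 < gam.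
Proof. exact: gamma_gt0 (run_start run). Qed.

(** * Evaluation counts *)

(** The side condition gamma eps w2 <= 1 says precisely that the bound
    1 + ln (gamma eps) / ln w2 on the trials per iteration is nonnegative. It
    follows from gamma t <= 1 when some iteration has t > eps, but must be
    supplied when x 0 already meets the tolerance. *)
Lemma evaluation_bounds (eps : R) : 0 < eps ->
  exists (K : nat) (ell : nat -> nat),
    [/\ forall k, (k < K)%N ->
          (eps%:E < `|theta g h (x k)|)%E /\
          first_accepted g h zeta x p lam k (ell k),
        (`|theta g h (x K)| <= eps%:E)%E,
        gam * eps * w2 <= 1 ->
          (function_evals m K ell)%:R
            <= function_bound m zeta w2 gam (f_gap g h (x 0%N)) eps
      & (gradient_evals m K)%:R
          <= gradient_bound m zeta gam (f_gap g h (x 0%N)) eps].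
Proof.
move=> eps0; have gam0 := run_gamma_gt0; have w20 := lt_trans w1_gt0 w12.
have [K [reach big small]] := stopping_iteration eps0.
have reachk k : (k <= K)%N -> reached g h zeta x p lam k.
  by move=> kK i ik; apply: reach; apply: leq_trans kK.
have absk k : (k <= K)%N -> (`|theta g h (x k)| = (tau (x k))%:E)%E.
  move=> /reachk rk; exact: abs_theta (reached_domG rk) (run_subproblem run rk).
have [ell acc] : {ell : nat -> nat & forall k, (k < K)%N ->
    first_accepted g h zeta x p lam k (ell k)}.
  apply: (choice (P := fun k l => (k < K)%N ->
    first_accepted g h zeta x p lam k l)) => k; have [kK|_] := ltnP k K; last by exists 0%N.
  by have [_ [l acc]] := reach k kK; exists l.
have K_le := iteration_bound eps0 reach big.
exists K, ell; split.
- by move=> k kK; rewrite (absk _ (ltnW kK)) lte_fin (big _ kK); split=> //; apply: acc.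
- by rewrite absk.
- move=> eps_small; set B := 1 + ln (gam * eps) / ln w2.
  have lnw2 : ln w2 < 0 by rewrite ln_lt0 // w20.
  have B0 : 0 <= B.
    have := ln_le0 eps_small; rewrite lnM ?posrE ?mulr_gt0 // => lnB.
    have : -1 <= ln (gam * eps) / ln w2 by rewrite ler_ndivlMr //; lra.
    by rewrite /B; lra.
  have ell_le k : (k < K)%N -> (ell k).+1%:R <= B.
    move=> kK; rewrite -natr1 addrC lerD2l.
    have rk := reachk k (ltnW kK); have [neq0 _] := reach k kK.
    have [_ lo up] := accepted_step rk (reached_domG rk) neq0 (acc k kK).
    apply: expr_ge_ln; [by rewrite w20 | exact: mulr_gt0 |].
    by apply: le_trans (le_trans lo up); rewrite ler_pM2l // ltW // big.
  rewrite /function_evals /function_bound -/B natrM ler_wpM2l //.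
  rewrite natrD addrC lerD2r natr_sum.
  apply: (@le_trans _ _ (K%:R * B)); last by rewrite mulrC -mulrA ler_wpM2l.
  rewrite mulr_natl -[X in _ <= _ *+ X]card_ord -sumr_const.
  by apply: ler_sum => k _; apply: ell_le.
- rewrite /gradient_evals /gradient_bound natrM ler_wpM2l //.
  by rewrite -natr1 lerD2r.
Qed.

End Problem.

(** * Asymptotics as the tolerance tends to zero *)

Section Asymptotics.
Context (R : realType) (m : nat).

Lemma gradient_bound_bigO (zeta gam gap : R) :
  gradient_bound m zeta gam gap =O_ ((0 : R)^'+) (fun eps : R => eps ^- 2).
Proof.
set c := gap / (zeta * gam).
apply/eqO_exP; exists (m%:R * (`|c| + 1) + 1) => /=.
  by rewrite ltr_wpDl // mulr_ge0 // addr_ge0.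
near=> e.
have e0 : 0 < e by near: e; exact: nbhs_right_gt.
have e1 : e < 1 by near: e; exact: nbhs_right_lt.
have E1 : 1 <= e ^- 2 by rewrite invf_ge1 ?exprn_gt0 // exprn_ile1 // ltW.
rewrite /gradient_bound -/c div1r (ger0_norm (le_trans ler01 E1)).
rewrite normrM normr_nat.
have : `|c * e ^- 2 + 1| <= (`|c| + 1) * e ^- 2.
  apply: le_trans (ler_normD _ _) _.
  by rewrite normrM normr1 (ger0_norm (le_trans ler01 E1)) mulrDl mul1r lerD2l.
move=> /(ler_wpM2l (ler0n R m)); lra.
Unshelve. all: by end_near. Qed.

Lemma function_bound_bigO (zeta w2 gam gap : R) : 0 < gam ->
  function_bound m zeta w2 gam gap
    =O_ ((0 : R)^'+) (fun eps : R => `|ln eps| * eps ^- 2).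
Proof.
move=> gam0; set c := gap / (zeta * gam).
pose C := 1 + (`|ln gam| + 1) * `|(ln w2)^-1|.
have C0 : 0 <= C by rewrite addr_ge0 // mulr_ge0 // addr_ge0.
apply/eqO_exP; exists (m%:R * (C * `|c| + 1) + 1) => /=.
  by rewrite ltr_wpDl // mulr_ge0 // addr_ge0 // mulr_ge0.
near=> e.
have e0 : 0 < e by near: e; exact: nbhs_right_gt.
(* This threshold makes |ln e| >= 1, so constants are absorbed in |ln e|. *)
have e1 : e < expR (-1) by near: e; apply: nbhs_right_lt; exact: expR_gt0.
have L1 : 1 <= `|ln e|.
  have : ln e <= -1 by rewrite -[leRHS]expRK ler_ln ?posrE ?expR_gt0 // ltW.
  by move=> le1; rewrite ler0_norm; lra.
have e_lt1 : e < 1 by rewrite (lt_trans e1) // expR_lt1; lra.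
have E1 : 1 <= e ^- 2 by rewrite invf_ge1 ?exprn_gt0 // exprn_ile1 // ltW.
set E := e ^- 2 in E1 *; set l := `|ln e| in L1 *.
have E0 : 0 <= E by exact: le_trans E1.
have l0 : 0 <= l by exact: le_trans L1.
rewrite /function_bound -/c div1r -/E (ger0_norm (mulr_ge0 l0 E0)).
rewrite normrM normr_nat.
have Clog : `|1 + ln (gam * e) / ln w2| <= C * l.
  apply: le_trans (ler_normD _ _) _.
  rewrite normr1 normrM lnM ?posrE // mulrDl mul1r lerD // mulrAC.
  apply: ler_wpM2r => //; apply: le_trans (ler_normD _ _) _.
  by rewrite mulrDl mul1r lerD2r ler_peMr.
have : `|(1 + ln (gam * e) / ln w2) * c * E + 1| <= (C * `|c| + 1) * (l * E).
  apply: le_trans (ler_normD _ _) _.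
  rewrite normr1 !normrM (ger0_norm E0) [leRHS]mulrDl mul1r.
  apply: lerD; last by rewrite -[1]mulr1 ler_pM.
  by rewrite [leRHS]mulrA ler_wpM2r // [leRHS]mulrAC ler_wpM2r.
move=> /(ler_wpM2l (ler0n R m)) H.
by apply: le_trans H _; rewrite [leLHS]mulrA ler_wpM2r ?mulr_ge0 ?lerDl.
Unshelve. all: by end_near. Qed.

End Asymptotics.

Theorem theorem13 (R : realType) (m n : nat) (m_gt0 : (0 < m)%N)
  (g : 'I_m -> 'rV[R]_n -> \bar R) (h : 'I_m -> 'rV[R]_n -> R)
  (h_C1 : forall j, continuously_differentiable (h j))
  (g_proper : forall j, proper_ext (g j))
  (g_convex : forall j, econvex (g j))
  (g_lsc : forall j, lower_semicontinuous (g j))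
  (domG_convex : convex_set (domG g))
  (domG_compact : compact (domG g))
  (Lg : 'I_m -> R) (Lg_gt0 : forall j, 0 < Lg j)
  (g_lip : forall j x y, edom (g j) x -> edom (g j) y ->
     (`|g j x - g j y| <= (Lg j * enorm (x - y)%R)%:E)%E)
  (L : 'I_m -> R) (L_gt0 : forall j, 0 < L j)
  (h_lip : forall j x y,
     enorm (grad (h j) x - grad (h j) y) <= L j * enorm (x - y))
  (Omega : R) (Omega_gt0 : 0 < Omega)
  (Omega_diam : (ediam (domG g) <= Omega%:E)%E)
  (zeta : R) (zeta01 : 0 < zeta < 1)
  (omega1 omega2 : R) (omega1_gt0 : 0 < omega1)
  (omega12 : omega1 < omega2) (omega2_lt1 : omega2 < 1)
  (x p : nat -> 'rV[R]_n) (lam : nat -> nat -> R)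
  (run : armijo_gcg_run g h zeta omega1 omega2 x p lam) :
  let gam := gamma g h Lg L Omega zeta omega1 in
  let gap := f_gap g h (x 0%N) in
  let F0 := (0 : R)^'+ in
  [/\ forall eps : R, 0 < eps ->
        exists (K : nat) (ell : nat -> nat),
          [/\ forall k, (k < K)%N ->
                (eps%:E < `|theta g h (x k)|)%E /\
                first_accepted g h zeta x p lam k (ell k),
              (`|theta g h (x K)| <= eps%:E)%E,
              (* for larger eps the right-hand side may drop below m *)
              gam * eps * omega2 <= 1 ->
                (function_evals m K ell)%:R
                  <= function_bound m zeta omega2 gam gap eps
            & (gradient_evals m K)%:R <= gradient_bound m zeta gam gap eps],
      function_bound m zeta omega2 gam gap
        =O_F0 (fun eps : R => `|ln eps| * eps ^- 2)
    & gradient_bound m zeta gam gap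
        =O_F0 (fun eps : R => eps ^- 2)].
Proof.
move=> gam gap F0; have h_diff j : forall y, differentiable (h j) y := (h_C1 j).1.
split=> [eps eps0||]; last exact: gradient_bound_bigO.
  exact: (evaluation_bounds m_gt0 h_diff g_proper g_convex Lg_gt0 g_lip L_gt0
    h_lip Omega_gt0 Omega_diam zeta01 omega1_gt0 omega12 omega2_lt1 run eps0).
apply: function_bound_bigO.
exact: (run_gamma_gt0 m_gt0 Lg_gt0 L_gt0 h_lip Omega_gt0 Omega_diam zeta01
  omega1_gt0 run).
Qed.
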